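(* For all $x\in[0,\pi_{3,6}/4)$, writing $s:=\sin_{3,6}x$, $$\sin_{3,6}(2x)=\frac{2^{5/3}s(1+s^6)}{\left((1-s^3)(1+6s^3+s^6)^{3/2}+(1+s^3)(1-6s^3+s^6)^{3/2}\right)^{2/3}}.$$
   Context: For $p,q>1$, let $\pi_{p,q}=2\int_0^1\frac{dt}{(1-t^q)^{1/p}}<\infty$, and let $\sin_{p,q}:[0,\pi_{p,q}/2)\to[0,1)$ be the inverse function of $y\mapsto\int_0^y \frac{dt}{(1-t^q)^{1/p}}$, $y\in[0,1)$. *)

(* Defs.v *)
From HB Require Import structures.
From mathcomp Require Import all_boot all_order all_algebra.
From mathcomp Require Import all_classical all_reals all_analysis.

Set Implicit Arguments.
Unset Strict Implicit.
Unset Printing Implicit Defensive.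

Import Order.TTheory GRing.Theory Num.Theory.
Import numFieldNormedType.Exports.

Local Open Scope classical_set_scope.
Local Open Scope ring_scope.

(* The integrand is nonnegative on `[0, 1], so the Lebesgue integral over
   `[0, 1] agrees with the improper Riemann integral; the value of the
   integrand at the endpoint 1 is irrelevant. *)
Definition arcsinpq (R : realType) (p q y : R) : R :=
  \int[@lebesgue_measure R]_(t in `[0, y]) ((1 - t `^ q) `^ p^-1)^-1.

(* For 1 < p and 1 < q the integral is finite, since 1 - t <= 1 - t `^ q on
   `[0, 1]; the junk value 0 of Rintegral for infinite integrals does not
   occur. *)
Definition pipq (R : realType) (p q : R) : R := 2 * arcsinpq p q 1.

(* The inverse of the bijection arcsinpq p q : `[0, 1[ -> `[0, pipq p q / 2[;
   its values outside of `[0, pipq p q / 2[ are irrelevant. *)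
Definition sinpq (R : realType) (p q : R) : R -> R :=
  'pinv_(fun=> 0) `[0, 1[ (arcsinpq p q).

(* Main.v *)
Require Import Defs.
From HB Require Import structures.
From mathcomp Require Import all_boot all_order all_algebra.
From mathcomp Require Import all_classical all_reals all_analysis.
From mathcomp Require Import measurable_realfun.
From mathcomp Require Import ring lra.

Import Order.TTheory GRing.Theory Num.Theory.
Import numFieldNormedType.Exports.

Set Implicit Arguments.
Unset Strict Implicit.

Local Open Scope classical_set_scope.
Local Open Scope ring_scope.

(* Write F(y) for the right-hand side with s replaced by y, put u = y^3,
   a = sqrt (1 + 6 u + u^2), b = sqrt (1 - 6 u + u^2),
   D = (1 - u) a^3 + (1 + u) b^3 and E = (1 - u) a^3 - (1 + u) b^3.
   Since D E = 32 u (1 + u^2)^3, one has F^3 = E / D, hence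
   1 - F^6 = 4 (1 - u^2) (a b)^3 / D^2; on the other hand
   F' = 2^(5/3) a b / D^(2/3).  Therefore
   F' / (1 - F^6)^(1/3) = 2 / (1 - y^6)^(1/3), so that arcsin(F y) and
   2 arcsin y have the same derivative, and both vanish at 0.  This holds as
   long as 1 - 6 u + u^2 >= 0.  At the first zero y0 of this quantity F = 1, so
   arcsin y0 is pi_{3,6} / 4 and the range of y is the one of the theorem. *)

(** * The generalized arcsine and its inverse on [[0, 1[] *)

Section arcsinpq_theory.
Context {R : realType} {p q : R}.
Hypothesis q_gt0 : 0 < q.
(* If the integral over [0, 1] were infinite then Rintegral would make it 0, so
   this hypothesis already contains integrability. *)
Hypothesis arcsin1_gt0 : 0 < arcsinpq p q 1.

Let w (t : R) := ((1 - t `^ q) `^ p^-1)^-1.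

Lemma integrable_arcsinpq :
  (@lebesgue_measure R).-integrable (`[0%R, 1%R] : set R) (EFin \o w).
Proof.
have mw : measurable_fun (`[0%R, 1%R] : set R) w.
  apply: measurable_funTS.
  rewrite (_ : w = fun t => (1 - t `^ q) `^ (- p^-1)); last first.
    by apply/funext => t; rewrite powRN.
  apply: (measurableT_comp (measurable_powR _)).
  by apply: measurable_funB => //=; exact: measurable_powR.
apply/integrableP; split; first exact/measurable_EFinP.
rewrite ltNge leye_eq; apply/negP => /eqP intw.
move: arcsin1_gt0; rewrite /arcsinpq /Rintegral.
rewrite (_ : integral _ _ _ = +oo%E) ?ltxx// -intw.
by apply: eq_integral => t _ /=; rewrite ger0_norm// invr_ge0 powR_ge0.
Qed.

Lemma continuous_arcsinpq : {within `[0, 1], continuous (arcsinpq p q)}.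
Proof. exact: parameterized_integral_continuous integrable_arcsinpq. Qed.

Lemma powR_lt1 (t : R) : 0 < t -> t < 1 -> t `^ q < 1.
Proof.
move=> t0 t1; rewrite [ltRHS](_ : 1 = 1 `^ q); last by rewrite powR1.
by apply: gt0_ltr_powR; rewrite // nnegrE ltW.
Qed.

Lemma is_derive_arcsinpq (y : R) : 0 < y -> y < 1 ->
  is_derive y 1 (arcsinpq p q) ((1 - y `^ q) `^ p^-1)^-1.
Proof.
move=> y0 y1.
have cw : {for y, continuous w}.
  have yq1 := powR_lt1 y0 y1.
  apply: (@cvgV _ _ _ _ _ ((1 - y `^ q) `^ p^-1)).
    by rewrite gt_eqF// powR_gt0// subr_gt0.
  have cpow (z r : R) : 0 < z -> {for z, continuous (@powR R ^~ r)}.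
    move=> z0; apply: differentiable_continuous; apply/derivable1_diffP.
    exact: (@ex_derive _ _ _ _ _ _ _ (@is_derive1_powR R r z z0)).
  apply: (@continuous_comp _ _ _ (fun t => 1 - t `^ q) (@powR R ^~ p^-1)).
    by apply: cvgB; [exact: cvg_cst|exact: cpow].
  by apply: cpow; rewrite subr_gt0.
have [dA A'] := continuous_FTC1_closed y1 integrable_arcsinpq y0 cw.
by apply: DeriveDef => //; rewrite -derive1E.
Qed.

Lemma arcsinpq_lt (x y : R) : 0 <= x -> x < y -> y <= 1 ->
  arcsinpq p q x < arcsinpq p q y.
Proof.
apply: gtr0_derive1_incr continuous_arcsinpq _ _ => z;
  rewrite in_itv/= => /andP[z0 z1].
  by have := is_derive_arcsinpq z0 z1 => -[].
have ? := is_derive_arcsinpq z0 z1.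
by rewrite derive1E derive_val invr_gt0 powR_gt0// subr_gt0 powR_lt1.
Qed.

Lemma arcsinpq0 : arcsinpq p q 0 = 0.
Proof. by rewrite /arcsinpq set_itv1 Rintegral_set1. Qed.

Lemma sinpq_arcsinpq (y : R) : 0 <= y -> y < 1 ->
  sinpq p q (arcsinpq p q y) = y.
Proof.
move=> y0 y1; apply: pinvKV; last by rewrite inE/= in_itv/= y0.
move=> a b; rewrite !inE/= !in_itv/= => /andP[a0 a1] /andP[b0 b1] ab.
case: (ltgtP a b) => // lt_ab.
  by have := arcsinpq_lt a0 lt_ab (ltW b1); rewrite ab ltxx.
by have := arcsinpq_lt b0 lt_ab (ltW a1); rewrite ab ltxx.
Qed.

(** Allows [x] to be replaced by an arcsine, so that the formula becomes a statement about [y]. *)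
Lemma arcsinpq_surj (x : R) : 0 <= x -> x < arcsinpq p q 1 ->
  exists2 y, 0 <= y < 1 & arcsinpq p q y = x.
Proof.
move=> x0 x1.
have [|y] := IVT ler01 continuous_arcsinpq (v := x).
  by rewrite arcsinpq0 minElt maxElt arcsin1_gt0 x0 ltW.
rewrite in_itv/= => /andP[y0 y1] yx; exists y => //.
by rewrite y0 lt_neqAle y1 andbT; apply: contra_ltN x1 => /eqP <-; rewrite yx.
Qed.

End arcsinpq_theory.

(** * Polynomial identities behind the formula, and roots as powers *)

Lemma dupl_den_conj (R : comNzRingType) (u a b : R) :
  a ^+ 2 = 1 + 6 * u + u ^+ 2 -> b ^+ 2 = 1 - 6 * u + u ^+ 2 ->
  ((1 - u) * a ^+ 3 + (1 + u) * b ^+ 3) * ((1 - u) * a ^+ 3 - (1 + u) * b ^+ 3)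
  = 32 * u * (1 + u ^+ 2) ^+ 3.
Proof.
(* As a difference of squares, the product contains only even powers of [a] and [b]. *)
move=> a2 b2; rewrite mulrC -subr_sqr !exprMn a2 b2; ring.
Qed.

(* The last factor is the derivative of D with respect to u. *)
Lemma dupl_log_deriv (R : comNzRingType) (u a b : R) :
  a ^+ 2 = 1 + 6 * u + u ^+ 2 -> b ^+ 2 = 1 - 6 * u + u ^+ 2 ->
  (1 + 7 * u ^+ 2 - a * b) * ((1 - u) * a ^+ 3 + (1 + u) * b ^+ 3)
  = 2 * u * (1 + u ^+ 2) *
    (a * (8 - 12 * u - 4 * u ^+ 2) + b * (- 8 - 12 * u + 4 * u ^+ 2)).
Proof.
move=> a2 b2.
(* Each coefficient of [a] and [b] is now even in both, hence a polynomial in [u]. *)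
rewrite (_ : (_ - _) * _ =
  a * ((1 + 7 * u ^+ 2) * (1 - u) * a ^+ 2 - (1 + u) * (b ^+ 2) ^+ 2) +
  b * ((1 + 7 * u ^+ 2) * (1 + u) * b ^+ 2 - (1 - u) * (a ^+ 2) ^+ 2));
  last by ring.
rewrite a2 b2; ring.
Qed.

Lemma powR_root {R : realType} (x : R) (n : nat) : (0 < n)%N -> 0 <= x ->
  (x `^ n%:R^-1) ^+ n = x.
Proof.
move=> n0 x0; rewrite -powR_mulrn ?powR_ge0// -powRrM mulVf ?powRr1//.
by rewrite pnatr_eq0 -lt0n.
Qed.

(** Reduces fractional powers to natural powers of one root, which [ring] and [field] can treat as a
    variable. *)
Lemma powR_frac {R : realType} (x r : R) (n : nat) :
  x `^ (n%:R / r) = (x `^ r^-1) ^+ n.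
Proof. by rewrite mulrC powRrM powR_mulrn// powR_ge0. Qed.

(** * The right-hand side as a function of [y]: its cube, derivative, continuity and bounds *)

Section duplication.
Context {R : realType}.
Implicit Types y : R.

Let P y : R := 1 + 6 * y ^+ 3 + y ^+ 6.
Let M y : R := 1 - 6 * y ^+ 3 + y ^+ 6.

(* Square roots instead of [powR] with exponent 3/2: [powR] is 1 on negative
   numbers, hence not continuous at 0. *)
Definition dupl36_den y :=
  (1 - y ^+ 3) * Num.sqrt (P y) ^+ 3 + (1 + y ^+ 3) * Num.sqrt (M y) ^+ 3.

Definition dupl36 y :=
  2 `^ (5 / 3) * y * (1 + y ^+ 6) / dupl36_den y `^ (2 / 3).

Let P_gt0 y : 0 <= y -> 0 < P y.
Proof.
by move=> y0; rewrite /P ltr_wpDr ?exprn_ge0// ltr_pwDl// mulr_ge0// exprn_ge0.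
Qed.

Lemma dupl36_den_gt0 y : 0 <= y -> y < 1 -> 0 < dupl36_den y.
Proof.
move=> y0 y1; apply: ltr_pwDl.
  rewrite mulr_gt0 ?exprn_gt0 ?sqrtr_gt0 ?P_gt0//.
  by rewrite subr_gt0 exprn_ilt1.
by rewrite mulr_ge0 ?exprn_ge0 ?sqrtr_ge0// addr_ge0// exprn_ge0.
Qed.

Lemma dupl36_cube y : 0 <= y -> y < 1 -> 0 <= M y ->
  dupl36 y ^+ 3 = 1 - 2 * (1 + y ^+ 3) * Num.sqrt (M y) ^+ 3 / dupl36_den y.
Proof.
move=> y0 y1 My.
have d0 := dupl36_den_gt0 y0 y1.
have key : dupl36_den y * ((1 - y ^+ 3) * Num.sqrt (P y) ^+ 3 -
    (1 + y ^+ 3) * Num.sqrt (M y) ^+ 3) = 32 * y ^+ 3 * (1 + y ^+ 6) ^+ 3.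
  rewrite dupl_den_conj -?exprM//; rewrite sqr_sqrtr -?exprM//.
  exact: ltW (P_gt0 y0).
have -> : dupl36 y ^+ 3 = 32 * y ^+ 3 * (1 + y ^+ 6) ^+ 3 / dupl36_den y ^+ 2.
  rewrite /dupl36 !powR_frac.
  have := @powR_root R 2 3 isT ltac:(by []).
  have := powR_root (n := 3) isT (ltW d0).
  have : dupl36_den y `^ 3^-1 != 0 by rewrite gt_eqF// powR_gt0.
  move: (dupl36_den y `^ 3^-1) (2 `^ 3^-1) => d c dn0 <- c3.
  (* With [c] the cube root of 2, the cube of [2 * c ^+ 2] is [8 * (c ^+ 3) ^+ 2], that is 32. *)
  have -> : c ^+ 5 = 2 * c ^+ 2 by rewrite -c3; ring.
  rewrite (_ : (_ / _) ^+ 3 =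
    8 * (c ^+ 3) ^+ 2 * y ^+ 3 * (1 + y ^+ 6) ^+ 3 / (d ^+ 3) ^+ 2).
    by rewrite c3; field.
  by field.
rewrite -key; move: d0; rewrite /dupl36_den => d0; field.
by rewrite gt_eqF.
Qed.

(** Since F^3 = E / D, the numerator is D^2 - E^2, four times the product of the two summands of
    D. *)
Lemma onem_dupl36_sixth y : 0 <= y -> y < 1 -> 0 <= M y ->
  1 - dupl36 y ^+ 6 = 4 * (1 - y ^+ 6) *
    (Num.sqrt (P y) * Num.sqrt (M y)) ^+ 3 / dupl36_den y ^+ 2.
Proof.
move=> y0 y1 My; have d0 := dupl36_den_gt0 y0 y1.
rewrite (exprM _ 3 2) (exprM y 3 2) dupl36_cube//.
move: d0; rewrite /dupl36_den => d0; field.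
by rewrite gt_eqF.
Qed.

Lemma is_derive_dupl36 y : 0 <= y -> y < 1 -> 0 < M y ->
  is_derive y 1 dupl36 (2 `^ (5 / 3) * Num.sqrt (P y) * Num.sqrt (M y) /
                        dupl36_den y `^ (2 / 3)).
Proof.
move=> y0 y1 My; have d0 := dupl36_den_gt0 y0 y1.
have Py := P_gt0 y0.
have dP : is_derive y 1 P (18 * y ^+ 2 + 6 * y ^+ 5).
  rewrite (_ : P = cst 1 + cst 6 * id ^+ 3 + id ^+ 6)//.
  apply: is_derive_eq; rewrite /GRing.scale/=.
ring.
have dM : is_derive y 1 M (- 18 * y ^+ 2 + 6 * y ^+ 5).
  rewrite (_ : M = cst 1 + cst (- 6) * id ^+ 3 + id ^+ 6); last first.
    by apply/funext => z; rewrite /M -mulNr.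
  apply: is_derive_eq; rewrite /GRing.scale/=; ring.
have dsP : is_derive y 1 (Num.sqrt \o P)
    ((2 * Num.sqrt (P y))^-1 * (18 * y ^+ 2 + 6 * y ^+ 5)).
  by apply: is_derive1_comp; exact: is_derive1_sqrt.
have dsM : is_derive y 1 (Num.sqrt \o M)
    ((2 * Num.sqrt (M y))^-1 * (- 18 * y ^+ 2 + 6 * y ^+ 5)).
  by apply: is_derive1_comp; exact: is_derive1_sqrt.
pose u := y ^+ 3.
have dD : is_derive y 1 dupl36_den (3 * y ^+ 2 *
   (Num.sqrt (P y) * (8 - 12 * u - 4 * u ^+ 2) +
    Num.sqrt (M y) * (- 8 - 12 * u + 4 * u ^+ 2))).
  rewrite (_ : dupl36_den = (cst 1 + - id ^+ 3) * (Num.sqrt \o P) ^+ 3 +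
     (cst 1 + id ^+ 3) * (Num.sqrt \o M) ^+ 3); last first.
    by apply/funext => z.
  apply: is_derive_eq; rewrite /GRing.scale/=.
  rewrite -[(cst 1 + - id ^+ 3) y]/(1 - y ^+ 3).
  rewrite -[(cst 1 + id ^+ 3) y]/(1 + y ^+ 3).
  rewrite -[((Num.sqrt \o P) ^+ 3) y]/(Num.sqrt (P y) ^+ 3).
  rewrite -[((Num.sqrt \o M) ^+ 3) y]/(Num.sqrt (M y) ^+ 3).
  have := sqr_sqrtr (ltW Py); have := sqr_sqrtr (ltW My).
  have : Num.sqrt (P y) != 0 by rewrite gt_eqF ?sqrtr_gt0.
  have : Num.sqrt (M y) != 0 by rewrite gt_eqF ?sqrtr_gt0.
  move: (Num.sqrt (P y)) (Num.sqrt (M y)) => a b b0 a0 b2 a2.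
  (* The inverse roots cancel against the cubes; what multiplies [a] and [b] involves only their
     squares. *)
  transitivity (3 * y ^+ 2 * (a * ((1 - u) * (9 + 3 * u) - a ^+ 2) +
      b * ((1 + u) * (- 9 + 3 * u) + b ^+ 2))).
    by rewrite /u; field; rewrite a0 b0.
  by rewrite a2 b2 /P /M /u; ring.
(* Product rule with D^(-2/3) / D factored out: 1 + 7 u^2 is the derivative of y (1 + y^6), and 2 u
   collects the 2/3 of the exponent, [y], and the 3 y^2 in D'. *)
have dF : is_derive y 1 dupl36
   (2 `^ (5 / 3) * (dupl36_den y `^ (- (2 / 3)) / dupl36_den y) *
    ((1 + 7 * u ^+ 2) * dupl36_den y - 2 * u * (1 + u ^+ 2) *
   (Num.sqrt (P y) * (8 - 12 * u - 4 * u ^+ 2) +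
    Num.sqrt (M y) * (- 8 - 12 * u + 4 * u ^+ 2)))).
  rewrite (_ : dupl36 = cst (2 `^ (5 / 3)) * id * (cst 1 + id ^+ 6) *
      ((@powR R ^~ (- (2 / 3))) \o dupl36_den)); last first.
    by apply/funext => z; rewrite /dupl36 -powRN.
  have dpow := is_derive1_comp (@is_derive1_powR R (- (2 / 3)) _ d0) dD.
  apply: is_derive_eq; rewrite /GRing.scale/=.
  rewrite powRD; last by apply/implyP => _; rewrite gt_eqF.
  rewrite powR_inv1 ?ltW//.
  rewrite -[(cst 1 + id ^+ 6) y]/(1 + y ^+ 6).
  rewrite -[(cst _ * id * _) y]/(2 `^ (5 / 3) * y * (1 + y ^+ 6)).
  rewrite -[(cst _ * id) y]/(2 `^ (5 / 3) * y).
  move: (_ `^ (- _)) (Num.sqrt (P y)) (Num.sqrt (M y)) (2 `^ _) => pd a b k.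
  by rewrite /u; field; rewrite gt_eqF.
apply: (is_derive_eq dF).
(* By this identity the last factor of [dF] is a b D, whose D cancels the denominator. *)
have := @dupl_log_deriv R u (Num.sqrt (P y)) (Num.sqrt (M y)).
rewrite !sqr_sqrtr ?ltW// /u -!exprM => /(_ erefl erefl) key.
rewrite -key powRN; move: d0; rewrite /dupl36_den.
move=> d0; have : dupl36_den y `^ (2 / 3) != 0 by rewrite gt_eqF// powR_gt0.
rewrite /dupl36_den; move: (_ `^ (2 / 3)) => pd pd0; field.
by rewrite pd0 gt_eqF.
Qed.

(** The differential equation for F with denominators cleared; it holds because 1 - F^6 has an
    explicit cube root. *)
Lemma dupl36_ode y : 0 <= y -> y < 1 -> 0 <= M y ->
  2 `^ (5 / 3) * Num.sqrt (P y) * Num.sqrt (M y) / dupl36_den y `^ (2 / 3) *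
    (1 - y ^+ 6) `^ 3^-1 = 2 * (1 - dupl36 y ^+ 6) `^ 3^-1.
Proof.
move=> y0 y1 My; have d0 := dupl36_den_gt0 y0 y1.
rewrite onem_dupl36_sixth// !powR_frac.
have y6 : 0 <= 1 - y ^+ 6 by rewrite subr_ge0 exprn_ile1// ltW.
have c3 := @powR_root R 2 3 isT ltac:(by []).
have r3 := powR_root (n := 3) isT y6.
have d3 := powR_root (n := 3) isT (ltW d0).
have dgt0 : 0 < dupl36_den y `^ 3^-1 by rewrite powR_gt0.
have r0 := powR_ge0 (1 - y ^+ 6) 3^-1.
have c0 := powR_ge0 (2 : R) 3^-1.
rewrite -[in RHS]r3 -[in RHS]d3.
move: (sqrtr_ge0 (P y)) (sqrtr_ge0 (M y)) dgt0 c3 r0 c0.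
move: (dupl36_den y `^ 3^-1) (2 `^ 3^-1) ((1 - y ^+ 6) `^ 3^-1) (Num.sqrt (P y))
  (Num.sqrt (M y)).
move=> d c r a b a0 b0 dgt0 c3 r0 c0.
(* The cube root of 1 - F^6; it must be nonnegative for [powR] to undo the cube. *)
pose z := c ^+ 2 * r * a * b / d ^+ 2.
have z0 : 0 <= z by rewrite divr_ge0 ?mulr_ge0 ?exprn_ge0// ltW.
rewrite (_ : 4 * _ * _ / _ = z ^+ 3); last first.
  rewrite (_ : 4 = (c ^+ 3) ^+ 2); last by rewrite c3; ring.
  by rewrite /z; field; rewrite gt_eqF.
rewrite -[z ^+ 3]powR_mulrn// -powRrM divff// powRr1//.
have -> : c ^+ 5 = 2 * c ^+ 2 by rewrite -c3; ring.
rewrite /z.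
by field; rewrite gt_eqF.
Qed.

(** Also covers the zero of [M], where [is_derive_dupl36] does not apply. *)
Lemma continuous_dupl36 y : 0 <= y -> y < 1 -> {for y, continuous dupl36}.
Proof.
move=> y0 y1; have d0 := dupl36_den_gt0 y0 y1.
have cX n : {for y, continuous (fun z : R => z ^+ n)}.
  by exact: exprn_continuous.
have cP : {for y, continuous P}.
  apply: cvgD; last exact: cX.
  by apply: cvgD; [exact: cvg_cst|apply: cvgM; [exact: cvg_cst|exact: cX]].
have cM : {for y, continuous M}.
  apply: cvgD; last exact: cX.
  by apply: cvgB; [exact: cvg_cst|apply: cvgM; [exact: cvg_cst|exact: cX]].
have cs (f : R -> R) : {for y, continuous f} ->
    {for y, continuous (fun z => Num.sqrt (f z) ^+ 3)}.
  move=> cf; apply: (continuous_comp (g := fun t => Num.sqrt t ^+ 3)) => //.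
  apply: (continuous_comp (f := @Num.sqrt R) (g := fun t => t ^+ 3));
    first exact: sqrt_continuous.
  exact: exprn_continuous.
have cD : {for y, continuous dupl36_den}.
  apply: cvgD; apply: cvgM; try exact: cs.
    by apply: cvgB; [exact: cvg_cst|exact: cX].
  by apply: cvgD; [exact: cvg_cst|exact: cX].
apply: cvgM.
  apply: cvgM; first by apply: cvgM; [exact: cvg_cst|exact: cvg_id].
  by apply: cvgD; [exact: cvg_cst|exact: cX].
apply: cvgV; first by rewrite gt_eqF// powR_gt0.
apply: (continuous_comp (f := dupl36_den) (g := @powR R ^~ (2 / 3))) => //.
apply: differentiable_continuous; apply/derivable1_diffP.
by apply: ex_derive; exact: is_derive1_powR.
Qed.

Lemma dupl36_ge0 y : 0 <= y -> 0 <= dupl36 y.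
Proof.
move=> y0; rewrite divr_ge0 ?powR_ge0//.
by rewrite !mulr_ge0 ?powR_ge0// addr_ge0// exprn_ge0.
Qed.

Lemma dupl36_gt0 y : 0 < y -> y < 1 -> 0 < dupl36 y.
Proof.
move=> y0 y1; rewrite divr_gt0 ?powR_gt0 ?dupl36_den_gt0 ?ltW//.
by rewrite !mulr_gt0 ?powR_gt0// addr_gt0// exprn_gt0.
Qed.

Lemma dupl36_le1 y : 0 <= y -> y < 1 -> 0 <= M y -> dupl36 y <= 1.
Proof.
move=> y0 y1 My; rewrite -(@expr_le1 _ 3) ?dupl36_ge0// dupl36_cube//.
rewrite gerBl divr_ge0//; last exact: ltW (dupl36_den_gt0 y0 y1).
by rewrite !mulr_ge0 ?exprn_ge0 ?sqrtr_ge0// addr_ge0// exprn_ge0.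
Qed.

Lemma dupl36_lt1 y : 0 <= y -> y < 1 -> 0 < M y -> dupl36 y < 1.
Proof.
move=> y0 y1 My; rewrite -(@expr_lt1 _ 3) ?dupl36_ge0//.
rewrite dupl36_cube//; last exact: ltW.
rewrite gtrBl divr_gt0 ?dupl36_den_gt0//.
by rewrite !mulr_gt0 ?exprn_gt0 ?sqrtr_gt0// ltr_pwDl ?exprn_ge0.
Qed.

Lemma dupl36_eq1 y : 0 <= y -> y < 1 -> M y = 0 -> dupl36 y = 1.
Proof.
move=> y0 y1 My; apply/eqP; rewrite -(@pexpr_eq1 _ _ 3) ?dupl36_ge0//.
by rewrite dupl36_cube ?My// sqrtr0 expr0n/= mulr0 mul0r subr0.
Qed.

End duplication.

(** * Duplication for the arcsine, then for the sine *)

Lemma dupl36_disc_gt0 {R : realType} (y z : R) : 0 <= z -> z < y -> y < 1 ->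
  0 <= 1 - 6 * y ^+ 3 + y ^+ 6 -> 0 < 1 - 6 * z ^+ 3 + z ^+ 6.
Proof.
move=> z0 zy y1; rewrite (exprM y 3 2) (exprM z 3 2).
have : z ^+ 3 < y ^+ 3 by rewrite ltrXn2r// ltW// (le_lt_trans z0).
have : y ^+ 3 < 1 by rewrite exprn_ilt1// ltW// (le_lt_trans z0).
(* The polynomial 1 - 6 u + u^2 is strictly decreasing on [0, 1]. *)
by move: (y ^+ 3) (z ^+ 3) => u v; nra.
Qed.

Lemma arcsinpq_dupl36 {R : realType} (y : R) : 0 < arcsinpq 3 6 (1 : R) ->
  0 <= y -> y < 1 -> 0 <= 1 - 6 * y ^+ 3 + y ^+ 6 ->
  arcsinpq 3 6 (dupl36 y) = 2 * arcsinpq 3 6 y.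
Proof.
move=> A1 y0 y1 My; set A := @arcsinpq R 3 6.
have q0 : 0 < 6 :> R by [].
have M_gt0 z : z \in `]0, y[ -> 0 < z /\ z < 1 /\ 0 < 1 - 6 * z ^+ 3 + z ^+ 6.
  rewrite in_itv/= => /andP[z0 zy]; rewrite z0 (lt_trans zy)//.
  do 2!split => //.
  exact: dupl36_disc_gt0 (ltW z0) zy _ _.
have dh z : z \in `]0, y[ -> is_derive z 1 (A \o dupl36 - cst 2 * A) 0.
  move=> /M_gt0[z0 [z1 Mz]].
  have F0 := dupl36_gt0 z0 z1; have F1 := dupl36_lt1 (ltW z0) z1 Mz.
  have dF := is_derive_dupl36 (ltW z0) z1 Mz.
  have dA := is_derive_arcsinpq q0 A1 z0 z1.
  have dAF := is_derive1_comp (is_derive_arcsinpq q0 A1 F0 F1) dF.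
  apply: is_derive_eq; rewrite /GRing.scale/= !mulr0 addr0.
  have := dupl36_ode (ltW z0) z1 (ltW Mz).
  rewrite !(powR_mulrn 6) ?(ltW z0) ?(ltW F0)//.
  have : (1 - z ^+ 6) `^ 3^-1 != 0.
    by rewrite gt_eqF// powR_gt0// subr_gt0 exprn_ilt1// ltW.
  have : (1 - dupl36 z ^+ 6) `^ 3^-1 != 0.
    by rewrite gt_eqF// powR_gt0// subr_gt0 exprn_ilt1// ltW.
  move: ((1 - dupl36 z ^+ 6) `^ 3^-1) ((1 - z ^+ 6) `^ 3^-1).
  move: (_ / dupl36_den z `^ (2 / 3)) => g f r f0 r0 grf.
  (* Multiplying by (1 - z^6)^(1/3) brings the derivative to the form of [dupl36_ode]. *)
  apply: (mulIf r0); rewrite mul0r mulrBl -mulrA grf.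
  by field; rewrite f0 r0.
have cA := continuous_arcsinpq A1.
have ch : {within `[0, y], continuous (A \o dupl36 - cst 2 * A)}.
  apply: within_continuousB.
    apply/subspace_continuousP => z /=; rewrite in_itv/= => /andP[z0 zy].
    have z1 : z < 1 := le_lt_trans zy y1.
    (* [A] is only known to be continuous within [0, 1], so F must stay there; it reaches 1 if the
       discriminant vanishes at [y]. *)
    have Fz w : 0 <= w <= y -> 0 <= dupl36 w <= 1.
      move=> /andP[w0]; rewrite dupl36_ge0//= le_eqVlt => /predU1P[->|wy].
        exact: dupl36_le1.
      apply/ltW/dupl36_lt1 => //; first exact: lt_trans y1.
      exact: dupl36_disc_gt0 w0 wy _ _.
    move/subspace_continuousP : cA => /(_ (dupl36 z)).
    rewrite /= in_itv/= Fz ?z0// => /(_ isT) cA.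
    apply: cvg_comp cA => W; rewrite /within/= => nW.
    have := continuous_dupl36 z0 z1 nW.
    rewrite /= !near_simpl; apply: filterS => w + wy; apply.
    by rewrite /= in_itv/= Fz.
  have cAy : {within `[0, y], continuous A}.
    apply: continuous_subspaceW cA.
    by apply: subset_itvl; rewrite bnd_simp ltW.
  by move=> z; apply: cvgM; [exact: cvg_cst|exact: cAy].
have [c _] := MVT_segment y0 dh ch.
rewrite mul0r => /eqP; rewrite subr_eq0.
rewrite -[(A \o dupl36 - cst 2 * A) y]/(A (dupl36 y) - 2 * A y).
rewrite -[(A \o dupl36 - cst 2 * A) 0]/(A (dupl36 0) - 2 * A 0).
have -> : dupl36 (0 : R) = 0 by rewrite /dupl36 mulr0 !mul0r.
rewrite /A arcsinpq0 mulr0 subrr subr_eq0.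
by move/eqP.
Qed.

Theorem theorem3p6 (R : realType) (x : R) :
  0 <= x -> x < pipq 3 6 / 4 ->
  let s := sinpq 3 6 x in
  sinpq 3 6 (2 * x) =
    2 `^ (5 / 3) * s * (1 + s ^+ 6) /
    ((1 - s ^+ 3) * (1 + 6 * s ^+ 3 + s ^+ 6) `^ (3 / 2)
     + (1 + s ^+ 3) * (1 - 6 * s ^+ 3 + s ^+ 6) `^ (3 / 2)) `^ (2 / 3).
Proof.
move=> x0 xlt s.
(* The range of [x] is nonempty only if pi_{3,6} is positive, which yields integrability. *)
have A1 : 0 < arcsinpq 3 6 (1 : R) by move: xlt; rewrite /pipq; lra.
have q0 : 0 < 6 :> R by [].
have [|y /andP[y0 y1] yx] := arcsinpq_surj A1 x0.
  by move: xlt; rewrite /pipq; lra.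
have sy : s = y by rewrite /s -yx (sinpq_arcsinpq q0).
rewrite {}sy {s}.
(* Otherwise the discriminant has a zero y' in [0, y]. There F = 1, so arcsin y' is pi_{3,6} / 4,
   and monotonicity gives pi_{3,6} / 4 <= x. *)
have My : 0 < 1 - 6 * y ^+ 3 + y ^+ 6.
  rewrite ltNge; apply/negP => My.
  have cM : {within `[0, y], continuous (fun z : R => 1 - 6 * z ^+ 3 + z ^+ 6)}.
    apply: continuous_subspaceT => z.
    apply: cvgD; last exact: exprn_continuous.
    apply: cvgB; first exact: cvg_cst.
    by apply: cvgM; [exact: cvg_cst|exact: exprn_continuous].
  have [|y' ] := IVT y0 cM (v := 0).
    rewrite !expr0n/= mulr0 subr0 addr0 minElt maxElt !ltNge.
    by rewrite (le_trans My)// My ler01.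
  rewrite in_itv/= => /andP[y'0 y'y] My'.
  have y'1 := le_lt_trans y'y y1.
  have := arcsinpq_dupl36 A1 y'0 y'1; rewrite My' lexx => /(_ isT).
  rewrite dupl36_eq1// => A1E.
  have : arcsinpq 3 6 y' <= x.
    move: y'y; rewrite le_eqVlt => /predU1P[->|y'y]; first by rewrite yx.
    by rewrite -yx ltW// arcsinpq_lt// ltW.
  by move: xlt; rewrite /pipq A1E; lra.
rewrite -[in LHS]yx -arcsinpq_dupl36//; last exact: ltW.
rewrite (sinpq_arcsinpq q0) ?dupl36_ge0 ?dupl36_lt1//.
(* Both radicands are nonnegative, so the powers 3/2 agree with cubes of square roots. *)
rewrite /dupl36 /dupl36_den !powR_frac !powR12_sqrt//; first exact: ltW.
by rewrite !addr_ge0 ?mulr_ge0 ?exprn_ge0.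
Qed.
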